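(* Let $s_1,s_2$ be nonnegative integers, let $D$ be the set of positive divisors of $\gcd(s_1,s_2)$, and let $G$ be the rotational group of the toroidal map $\{4,4\}_{(s_1,s_2)}$. If $s_1+s_2>2$, then the set of all possible degrees of a faithful transitive permutation representation of $G$ is $$\Big\{s_1^2+s_2^2\Big\}\cup\Big\{\tfrac{2(s_1^2+s_2^2)}{d}\ \Big|\ d\in D\Big\}\cup\Big\{\tfrac{4(s_1^2+s_2^2)}{d}\ \Big|\ d\in D\Big\}.$$ If $(s_1,s_2)\in\{(0,2),(2,0)\}$, then this set of degrees is $\{8,16\}$.
   Context: The rotational group (orientation-preserving automorphism group) of the toroidal map $\{4,4\}_{(s_1,s_2)}$ is the group $$G=\langle a,b\mid a^4=b^4=(ab)^2=1,\ u^{s_1}v^{s_2}=1\rangle,\qquad u:=ab^{-1},\ v:=a^{-1}b,$$ where $a$ is a rotation around a face, $b$ a rotation around a vertex, and $u,v$ are the unit translations. A faithful transitive permutation representation of $G$ of degree $n$ is a faithful transitive action of $G$ on a set of size $n$; equivalently, $n$ is the index in $G$ of a core-free subgroup (a subgroup $H$ with $\bigcap_{g\in G}g^{-1}Hg=1$). Convention: $\gcd(s,0)=\gcd(0,s)=s$. *)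

(* Defs.v *)
From mathcomp Require Import all_boot all_fingroup.

Set Implicit Arguments.
Unset Strict Implicit.
Unset Printing Implicit Defensive.

Local Open Scope group_scope.

(* [\isog Grp] determines the largest finite quotient of the presented group.
   Unless s1 = s2 = 0 the presented group is finite (the translations
   u = a b^-1 and v = a^-1 b commute and have finite order, and they generate a
   normal subgroup of index at most 4), so G is isomorphic to the presented
   group itself. *)
Definition rotational_group_44 (s1 s2 : nat) (gT : finGroupType)
    (G : {group gT}) : Prop :=
  G \isog Grp (a : b : a ^+ 4, b ^+ 4, (a * b) ^+ 2,
                       (a * b^-1) ^+ s1 * (a^-1 * b) ^+ s2).

Definition faithful_transitive_degree (gT : finGroupType) (G : {group gT})
    (n : nat) : Prop :=
  exists (T : finType) (to : action G T),
    [/\ #|T| = n, [transitive G, on [set: T] | to]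
      & [faithful G, on [set: T] | to]].

(* Main.v *)
Require Import Defs.
From mathcomp Require Import all_boot all_fingroup all_solvable all_algebra.
From mathcomp Require Import ring zify.

(** The group is an extension G = T ><| <[b]> of the translation group
T = <u, v> by the rotation b of order 4.  Identify u with 1 and v with i; then
T is Z[i]/(s1 + s2 i), conjugation by b is multiplication by -i, and
N = s1^2 + s2^2 is the order of T.  Degrees are indices of core-free subgroups
([faithful_transitive_degreeP]), so the orders of core-free subgroups H are to
be found.

Upper bound.  Put g = gcd(s1, s2), and let K = H :&: T, a subgroup whose core
is K :&: K :^ b.  The cyclic group C = <u^g> equals <u> :&: <v>, is normal in
G and contains every g-th power of T.  All subgroups of a normal cyclic group
are normal, so K avoids C and K has exponent dividing g.  Then K \x K :^ b is a
subgroup of T of exponent dividing g; its intersection with <u> has order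
dividing g, and so does its index modulo <u>, because #|T : <u>| = g.  So
#|K|^2 divides g^2 and #|K| divides g ([corefree_translations_dvd]).  The
index of K in H divides 4, and index 4 makes K normal in G, hence trivial
([corefree_card]).

Existence.  If d divides g then (s1 + s2 i)/d generates a subgroup K of T of
order d that meets its conjugate trivially ([corefree_cyclic]).  When the
exponent N/g of T exceeds 2, the rotation b^2, which inverts T, does not
centralise T; so T is its own centraliser and core-freeness can be tested
inside T ([gcore_translations_trivg]).  Hence K, K <*> <[b ^+ 2]> and <[b]> are
core-free, of orders d, 2d and 4.  For (2, 0) and (0, 2) the exponent of T
is 2, the centre contains the group <uv, b^2> of order 4, and this leaves room
for core-free subgroups of order 1 and 2 only
([card_corefree_small]).

All this needs to know which words u^m v^n are trivial in the presented group.
The relations give one direction; for the other, the presentation is mapped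
onto a group of affine permutations of (Z/N)[i], in which u is the translation
by the conjugate s1 - s2 i.  There u^m v^n is the translation by
(m + n i)(s1 - s2 i), which vanishes modulo N exactly when s1 + s2 i divides
m + n i ([rotational_group_44_frame]). *)

Set Implicit Arguments.
Unset Strict Implicit.
Unset Printing Implicit Defensive.

(** * Degrees as indices of core-free subgroups *)

Section CoreFree.
Local Open Scope group_scope.

(** A point stabiliser is core-free because its core fixes the whole orbit;
conversely [G] acts on the cosets of [H] with kernel the core of [H]. *)
Lemma faithful_transitive_degreeP (gT : finGroupType) (G : {group gT}) n :
  faithful_transitive_degree G n <->
  exists H : {group gT}, [/\ H \subset G, gcore H G = 1 & #|G : H| = n].
Proof.
split=> [[T [to [cardT transG faithG]]] | [H [sHG coreH <-]]].
  have /imsetP[x _ orbx] := transG.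
  exists 'C_G[x | to]%G; split; first exact: subsetIl.
    apply/trivgP; apply: subset_trans faithG.
    rewrite subsetI (subset_trans (gcore_sub _ _)) ?subsetIl //=.
    apply/subsetP=> c core_c.
    have Gc: c \in G by case/setIP: (subsetP (gcore_sub _ _) _ core_c).
    rewrite !inE Gc; apply/subsetP=> y _; rewrite inE; apply/eqP.
    have: y \in orbit to G x by rewrite -orbx inE.
    case/orbitP=> h Gh <-{y}.
    have: c ^ h^-1 \in 'C_G[x | to].
      apply: (subsetP (gcore_sub _ G)).
      by rewrite memJ_norm // groupV (subsetP (gcore_norm _ _)).
    case/setIP=> Gch /(astab_act)/(_ (set11 x)) fix_x.
    by rewrite -actMin // (conjgCV h c) actMin // fix_x.
  by rewrite -card_orbit_in // -orbx cardsT.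
have actG := actsRs_rcosets H G.
pose T : finType := {X : {set gT} | X \in rcosets H G}.
have sGD : G \subset subact_dom (mem (rcosets H G)) 'Rs.
  apply: subset_trans actG _; rewrite /subact_dom.
  by rewrite (_ : [set x | _] = rcosets H G) //; apply/setP=> A; rewrite inE.
(* Right translation, restricted to the type of cosets and to the group [G]. *)
pose to : action G T := (('Rs)^? \ sGD)%act.
have valT: val @: [set: T] = rcosets H G.
  apply/setP=> X; apply/imsetP/idP=> [[Y _ ->]|HX]; first exact: (valP Y).
  by exists (Sub X HX); rewrite ?inE ?SubK.
exists T, to; split.
- by rewrite card_sig; apply: eq_card => X; rewrite inE.
- pose X0 : T := Sub (H : {set gT}) (orbit_refl 'Rs G H).
  apply/imsetP; exists X0; rewrite ?inE //; apply/setP=> X; rewrite inE.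
  have /rcosetsP[g Gg defX] := valP X.
  symmetry; apply/orbitP; exists g => //; apply: val_inj.
  rewrite /= /ract val_subact (subsetP sGD) //.
  exact: etrans (rcosetE _ _) (esym defX).
- rewrite /faithful astab_ract astab_subact valT astabRs_rcosets coreH.
  by rewrite !setIA subsetIr.
Qed.

End CoreFree.

(** * The universal property of the presentation *)

Section UniversalProperty.
Local Open Scope group_scope.

(** The defining property of the presented group compares quotients of [G] only
up to isomorphism and does not follow generators.  To send [a] to [c] and [b]
to [d], consider the subgroup generated by [(a, c)] and [(b, d)]: it satisfies
the relations, so it is a quotient of [G], yet its first projection is onto
[G].  By cardinality it is the graph of the required morphism. *)
Lemma rotational_group_44_universal s1 s2 (gT : finGroupType) (G : {group gT}) :
  rotational_group_44 s1 s2 G ->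
  exists a b : gT,
    [/\ <[a]> <*> <[b]> = G, a ^+ 4 = 1, b ^+ 4 = 1, (a * b) ^+ 2 = 1
      & (a * b^-1) ^+ s1 * (a^-1 * b) ^+ s2 = 1] /\
    forall (rT : finGroupType) (c d : rT),
      c ^+ 4 = 1 -> d ^+ 4 = 1 -> (c * d) ^+ 2 = 1 ->
      (c * d^-1) ^+ s1 * (c^-1 * d) ^+ s2 = 1 ->
    exists2 f : {morphism G >-> rT}, f a = c & f b = d.
Proof.
move=> isoG; have /existsP[[a b] /=] := isoGrp_hom isoG.
case/eqP=> defG a4 b4 ab2 rel_ab.
exists a, b; split=> [//|rT c d c4 d4 cd2 rel_cd].
pose P := (<[(a, c)]> <*> <[(b, d)]>)%G.
have Pa : (a, c) \in P by rewrite mem_gen // inE cycle_id.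
have Pb : (b, d) \in P by rewrite mem_gen // inE cycle_id orbT.
have homP : P \homg G.
  rewrite isoG; apply/existsP; exists ((a, c), (b, d)) => /=.
  have pairM (x y : gT) (z t : rT) : (x, z) * (y, t) = (x * y, z * t) by [].
  have pairV (x : gT) (z : rT) : (x, z)^-1 = (x^-1, z^-1) by [].
  have pairX n (x : gT) (z : rT) : (x, z) ^+ n = (x ^+ n, z ^+ n).
    by elim: n => // n IHn; rewrite !expgS IHn.
  by rewrite !(pairV, pairM, pairX) a4 b4 ab2 rel_ab c4 d4 cd2 rel_cd !eqxx.
pose p1 := restrm_morphism (subsetT P) [morphism of (fun x : gT * rT => x.1)].
have sGP : G \subset p1 @* P.
  rewrite -defG join_subG !cycle_subG; apply/andP; split.
    exact: (mem_morphim p1 Pa Pa).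
  exact: (mem_morphim p1 Pb Pb).
have injp1 : 'injm p1.
  rewrite -card_im_injm eqn_leq leq_morphim.
  exact: leq_trans (leq_homg homP) (subset_leq_card sGP).
pose f x := (invm injp1 x).2.
have fM : {in G &, {morph f : x y / x * y}}.
  by move=> x y /(subsetP sGP)? /(subsetP sGP)?; rewrite /f morphM.
exists (Morphism fM); rewrite /= /f; first by rewrite (invmE injp1 Pa).
by rewrite (invmE injp1 Pb).
Qed.

End UniversalProperty.

(** * Affine permutations of the Gaussian integers over a finite ring *)

Section AffineModel.
Import GRing.Theory.
Local Open Scope ring_scope.
Variable R : finComNzRingType.

Definition translation (w : R * R) : {perm R * R} := perm (addIr w).
(** A pair [(x, y)] stands for [x + y i]; this is the multiplication by [- i],
the sign that makes [u ^ b = v^-1] and [v ^ b = u]. *)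
Definition quarter_turn_fun (z : R * R) : R * R := (z.2, - z.1).

Lemma quarter_turn_inj : injective quarter_turn_fun.
Proof. by case=> x y [z t] [-> /oppr_inj->]. Qed.

Definition quarter_turn : {perm R * R} := perm quarter_turn_inj.

Lemma translationX w n : (translation w ^+ n)%g = translation (w *+ n).
Proof.
apply/permP=> z; rewrite permX permE.
elim: n => [|n IHn]; first by rewrite addr0.
by rewrite iterS IHn permE mulrSr addrA.
Qed.

Lemma translationM w1 w2 :
  (translation w1 * translation w2)%g = translation (w1 + w2).
Proof. by apply/permP=> z; rewrite permM !permE addrA. Qed.

Lemma translation_inj : injective translation.
Proof. by move=> w1 w2 /permP/(_ 0); rewrite !permE !add0r. Qed.

Lemma quarter_turn4 : (quarter_turn ^+ 4 = 1)%g.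
Proof.
by apply/permP=> -[x y]; rewrite permX /= !permE /quarter_turn_fun /= !opprK.
Qed.

(** The displacement on the right is [(m + n i) (r1 - r2 i)]. *)
Lemma unit_translationsE (r1 r2 : R) m n :
  (translation (r1, - r2) ^+ m * translation (r2, r1) ^+ n)%g =
  translation (r1 *+ m + r2 *+ n, r1 *+ n - r2 *+ m).
Proof.
have pair_mulrn x y k : (x, y) *+ k = (x *+ k, y *+ k) :> R * R.
  by elim: k => [|k IHk]; rewrite ?mulr0n // !mulrS IHk.
rewrite !translationX translationM !pair_mulrn; congr translation.
by congr (_, _); rewrite /= mulNrn addrC.
Qed.

(** The relations hold for a quarter turn [d] and the quarter turn [c] obtained
from it by the translation [r1 - r2 i]; the last one says that
[(s1 + s2 i) (s1 - s2 i) = 0]. *)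
Lemma affine_model (s1 s2 : nat) (r1 := s1%:R : R) (r2 := s2%:R : R) :
  (s1 ^ 2 + s2 ^ 2)%:R = 0 :> R ->
  let d := quarter_turn in
  let c := (translation (r1, - r2) * d)%g in
  [/\ c ^+ 4 = 1, (c * d) ^+ 2 = 1, c * d^-1 = translation (r1, - r2),
      c^-1 * d = translation (r2, r1) &
      (c * d^-1) ^+ s1 * (c^-1 * d) ^+ s2 = 1]%g.
Proof.
move=> N0 d c.
have cdV : (c * d^-1 = translation (r1, - r2))%g by rewrite mulgK.
have cVd : (c^-1 * d = translation (r2, r1))%g.
  apply: (canLR (mulKg _)); apply/permP=> -[x y].
  rewrite !permM !permE /quarter_turn_fun /=.
  by congr (_, _) => /=; ring.
split=> //.
- apply/permP=> -[x y]; rewrite permX /= !(permM, permE) /quarter_turn_fun /=.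
  by congr (_, _) => /=; ring.
- apply/permP=> -[x y]; rewrite permX /= !(permM, permE) /quarter_turn_fun /=.
  by congr (_, _) => /=; ring.
- rewrite cdV cVd unit_translationsE -!mulrnA -mulrnDr !mulnn N0 mulnC subrr.
  by apply/permP=> z; rewrite permE perm1 addr0.
Qed.

End AffineModel.

(** * Translations and rotations in the presented group *)

Section Frame.
Local Open Scope group_scope.

(** [frame_lattice] says that a word [u ^+ m * v ^+ n] determines
[(m + n i) (s1 - s2 i)] modulo [N], that is, [m + n i] modulo [s1 + s2 i].
Its two sides keep the exponents in [nat]. *)
Record torus_frame (s1 s2 : nat) (gT : finGroupType) (G : {group gT})
    (b u v : gT) : Prop := TorusFrame {
  frame_gen : <[u]> <*> <[b]> = G;
  frame_b4 : b ^+ 4 = 1;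
  frame_uJ : u ^ b = v^-1;
  frame_vJ : v ^ b = u;
  frame_comm : commute u v;
  frame_rel : u ^+ s1 * v ^+ s2 = 1;
  frame_lattice : forall m1 n1 m2 n2 : nat,
    u ^+ m1 * v ^+ n1 = u ^+ m2 * v ^+ n2 ->
    (m1 * s1 + n1 * s2 = m2 * s1 + n2 * s2 %[mod s1 ^ 2 + s2 ^ 2])%N /\
    (n1 * s1 + m2 * s2 = n2 * s1 + m1 * s2 %[mod s1 ^ 2 + s2 ^ 2])%N;
  frame_b2 : forall m n : nat, b ^+ 2 <> u ^+ m * v ^+ n
}.

(** The equalities are computed from the relations, and the last two fields are
read off the affine model over the integers modulo [N]; the condition [2 < N]
makes [-1] differ from [1] there, so that the half turn is not trivial. *)
Lemma rotational_group_44_frame s1 s2 (gT : finGroupType) (G : {group gT}) :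
    rotational_group_44 s1 s2 G -> (2 < s1 ^ 2 + s2 ^ 2)%N ->
  exists b u v : gT, torus_frame s1 s2 G b u v.
Proof.
move=> isoG; set N := (s1 ^ 2 + s2 ^ 2)%N => N_gt2.
have [a [b [[defG a4 b4 ab2 rel_ab] univG]]] :=
  rotational_group_44_universal isoG.
have N_gt1 : (1 < N)%N by apply: ltnW.
pose R := 'Z_N.
have natR (m n : nat) : m%:R%R = n%:R%R :> R -> m = n %[mod N].
  by move/(congr1 val); rewrite /= !val_Zp_nat.
have N0 : (N%:R = 0 :> R)%R by rewrite pchar_Zp.
have [c4 cd2 cdV cVd rel_cd] := affine_model N0.
have [f fa fb] := univG _ _ _ c4 (quarter_turn4 _) cd2 rel_cd.
have Ga : a \in G by rewrite -defG mem_gen // inE cycle_id.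
have Gb : b \in G by rewrite -defG mem_gen // inE cycle_id orbT.
have fu : f (a * b^-1) = translation (s1%:R, - s2%:R)%R.
  by rewrite morphM ?morphV ?groupV // fa fb.
have fv : f (a^-1 * b) = translation (s2%:R, s1%:R)%R.
  by rewrite morphM ?morphV ?groupV // fa fb.
exists b, (a * b^-1), (a^-1 * b).
set u := a * b^-1 in fu *; set v := _ * b in fv *.
have Gu : u \in G by rewrite groupM ?groupV.
have Gv : v \in G by rewrite groupM ?groupV.
have fuv m n : f (u ^+ m * v ^+ n) =
    translation (s1%:R *+ m + s2%:R *+ n, s1%:R *+ n - s2%:R *+ m)%R.
  by rewrite morphM ?groupX // !morphX // fu fv unit_translationsE.
have uJ : u ^ b = v^-1 by rewrite /conjg /u /v mulgKV invMg invgK.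
have abV : b^-1 * a^-1 = a * b.
  by apply: (mulgI (a * b)); rewrite -invMg mulgV; symmetry.
split=> //.
- apply/eqP; rewrite eqEsubset -{2}defG !join_subG !cycle_subG Gu Gb /=.
  by rewrite -{1}[a](mulgKV b) groupM // mem_gen // inE cycle_id ?orbT.
- have bV : b ^+ 3 = b^-1 by apply: (mulgI b); rewrite -expgS mulgV.
  by rewrite /conjg /v !mulgA abV -!mulgA /u -bV.
- (* Both products are equal to [a * a * (b * b)]. *)
  have baV : b * a = a^-1 * b^-1.
    by apply: (mulgI a); rewrite mulgA -abV mulgKV mulKVg.
  have aa : a^-1 * a^-1 = a * a.
    by apply: (mulgI (a * a)); rewrite -invMg mulgV; symmetry; rewrite -mulgA.
  have bb : b^-1 * b^-1 = b * b.
    by apply: (mulgI (b * b)); rewrite -invMg mulgV; symmetry; rewrite -mulgA.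
  rewrite /commute /u /v !mulgA -(mulgA a) abV.
  rewrite -(mulgA a^-1) baV !mulgA aa.
  by rewrite -(mulgA _ b^-1) bb !mulgA.
- move=> m1 n1 m2 n2 eq_uv; have:= fuv m1 n1; rewrite eq_uv fuv.
  move/translation_inj/eqP; rewrite xpair_eqE -!GRing.mulrnA -!GRing.mulrnDr.
  case/andP=> /eqP/natR eq1; rewrite GRing.subr_eq GRing.addrAC.
  rewrite eq_sym GRing.subr_eq -!GRing.mulrnDr => /eqP/natR eq2.
  by rewrite ![(_ * s1)%N]mulnC ![(_ * s2)%N]mulnC.
- move=> m n b2; have := fuv m n; rewrite -b2 morphX // fb => d2.
  (* The half turn fixes 0, so it can only be the trivial translation. *)
  have d20 : (quarter_turn R ^+ 2 = 1)%g.
    rewrite d2 (_ : (_, _) = 0%R).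
      by apply/permP=> z; rewrite permE perm1 GRing.addr0.
    move/permP/(_ 0%R): d2; rewrite permX /= !permE /quarter_turn_fun /=.
    by rewrite GRing.oppr0 GRing.add0r.
  have neg1 : (- 1 = 1 :> R)%R.
    move/permP/(_ (1, 0)%R)/(congr1 fst): d20.
    by rewrite permX perm1 /= !permE.
  have /natR : 2%:R%R = 0%:R%R :> R.
    by rewrite GRing.mulr0n -(GRing.subrr 1%R) neg1.
  by rewrite mod0n modn_small.
Qed.

End Frame.

(** * Structure of the translation group *)

Section FrameTheory.
Local Open Scope group_scope.

Lemma coprime_expg_in (gT : finGroupType) (H : {group gT}) x p q :
  coprime p q -> x ^+ p \in H -> x ^+ q \in H -> x \in H.
Proof.
case: p => [|p]; first by rewrite /coprime gcd0n => /eqP-> _; rewrite expg1.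
case/(coprimeP _ (ltn0Sn p)) => -[k l] /= kl Hp Hq.
rewrite -[x]expg1 -kl expgnFr; last by lia.
by rewrite groupM ?groupV // mulnC expgnA groupX.
Qed.

Variables (g p q : nat) (gT : finGroupType) (G : {group gT}) (b u v : gT).
Hypotheses (g_gt0 : (0 < g)%N) (copq : coprime p q).
Hypothesis F : torus_frame (g * p) (g * q) G b u v.

(* Here [g = gcd(s1, s2)], the order of [T] is [N = g * (g * n)], and its
   exponent is [g * n]. *)
Local Notation n := (p ^ 2 + q ^ 2)%N.
Local Notation T := (<[u]> <*> <[v]>)%G.
Local Notation C := <[u ^+ g]>%G.

Let n_gt0 : (0 < n)%N.
Proof.
rewrite lt0n; apply/eqP=> n0; have [p0 q0] : p = 0 /\ q = 0 by nia.
by move: copq; rewrite p0 q0.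
Qed.

Let defN : ((g * p) ^ 2 + (g * q) ^ 2 = g * (g * n))%N.
Proof. by nia. Qed.

Let cuv : <[v]> \subset 'C(<[u]>).
Proof.
by rewrite cent_cycle cycle_subG; apply/cent1P/commute_sym/(frame_comm F).
Qed.

Let Tu : u \in T. Proof. by rewrite mem_gen // inE cycle_id. Qed.
Let Tv : v \in T. Proof. by rewrite mem_gen // inE cycle_id orbT. Qed.

Lemma translations_abelian : abelian T.
Proof. by rewrite abelianY !cycle_abelian. Qed.

Lemma translationsP x : x \in T -> exists i j, x = u ^+ i * v ^+ j.
Proof.
rewrite /= cent_joinEr //.
by case/mulsgP=> _ _ /cycleP[i ->] /cycleP[j ->] ->; exists i, j.
Qed.

Let vgu : v = u ^ b^-1.
Proof. by rewrite -(frame_vJ F) conjgK. Qed.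

Let Gu : u \in G. Proof. by rewrite -(frame_gen F) mem_gen // inE cycle_id. Qed.
Let Gb : b \in G.
Proof. by rewrite -(frame_gen F) mem_gen // inE cycle_id orbT. Qed.
Let Gv : v \in G. Proof. by rewrite vgu groupJ ?groupV. Qed.

Lemma translations_normal : T <| G.
Proof.
rewrite /normal join_subG !cycle_subG Gu Gv /=.
rewrite -{1}(frame_gen F) join_subG !cycle_subG.
have /= -> := subsetP (normG T) u Tu.
rewrite inE /= conjYg -!cycleJ (frame_uJ F) (frame_vJ F).
by rewrite cycleV joingC.
Qed.

Lemma order_b : #[b] = 4.
Proof.
have : #[b] %| 4 by rewrite order_dvdn (frame_b4 F).
have : ~~ (#[b] %| 2).
  rewrite order_dvdn; apply/eqP=> b2; apply: (@frame_b2 _ _ _ _ _ _ _ F 0 0).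
  by rewrite b2 mulg1.
by case: #[b] => [|[|[|[|[]]]]] //= *.
Qed.

Lemma half_turn_notin_translations : b ^+ 2 \notin T.
Proof. by apply/negP=> /translationsP[i [j /(frame_b2 F)]]. Qed.

Lemma translations_sdprod : T ><| <[b]> = G.
Proof.
have sGNT := normal_norm translations_normal.
have sbG : <[b]> \subset G by rewrite cycle_subG.
rewrite sdprodE ?(subset_trans sbG) //.
  rewrite -norm_joinEr ?(subset_trans sbG) //; apply/eqP.
  rewrite eqEsubset join_subG (normal_sub translations_normal) sbG /=.
  by rewrite -{1}(frame_gen F) genS // setSU // cycle_subG.
apply/trivgP/subsetP=> x /setIP[Tx /cyclePmin[i]].
rewrite order_b => lti4 def_x; have b2T := negP half_turn_notin_translations.
have b4 := frame_b4 F; case: i lti4 def_x => [|[|[|[|]]]] // _ def_x.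
- by rewrite def_x inE.
- by case: b2T; rewrite groupX // -[b]expg1 -def_x.
- by case: b2T; rewrite -def_x.
- (* [b ^+ 2 = (b ^+ 3) ^+ 2], because [b ^+ 4 = 1]. *)
  case: b2T; rewrite -[b ^+ 2]mul1g -b4 -expgnDr (expgnA b 3 2).
  by rewrite groupX -?def_x.
Qed.

Lemma card_rotational : #|G| = (4 * #|T|)%N.
Proof. by rewrite -(sdprod_card translations_sdprod) -orderE order_b mulnC. Qed.

(** The conjugate by [b] of the defining relation: the relation times [- i]. *)
Lemma relation_v : v ^+ (g * p) = u ^+ (g * q).
Proof.
have := congr1 (fun x => x ^ b) (frame_rel F).
rewrite conj1g conjMg !conjXg (frame_uJ F) (frame_vJ F) expgVn.
by move/(canRL (mulKVg _)); rewrite mulg1.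
Qed.

Lemma relation_u : u ^+ (g * p) = v ^- (g * q).
Proof. by apply/eqP; rewrite eq_mulgV1 invgK; apply/eqP/(frame_rel F). Qed.

(** The exponent [N / g = g p p + g q q] kills [u] by the two relations;
conversely the lattice condition makes [g n] divide [m p] and [m q] for [m] the
order of [u]. *)
Lemma order_u : #[u] = (g * n)%N.
Proof.
apply/eqP; rewrite eqn_dvd; apply/andP; split.
  rewrite order_dvdn.
  have gpq : (g * n = g * p * p + g * q * q)%N by nia.
  rewrite gpq expgnDr !(expgnA _ (g * _)) -relation_v relation_u.
  rewrite expgVn -!expgnA.
  by rewrite (_ : g * q * p = g * p * q)%N ?mulVg //; nia.
set m := #[u]; have um : u ^+ m * v ^+ 0 = u ^+ 0 * v ^+ 0.
  by rewrite expg_order.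
have [] := frame_lattice F um.
rewrite defN !mul0n !addn0 !add0n => /eqP eq1 /eqP eq2.
move: eq1; rewrite mod0n -/(dvdn _ _) !(mulnCA m g) dvdn_pmul2l // => dvd1.
move: eq2; rewrite eq_sym mod0n -/(dvdn _ _) !(mulnCA m g) dvdn_pmul2l //.
move=> dvd2.
have : (g * n %| m * gcdn p q)%N by rewrite muln_gcdr dvdn_gcd dvd1.
by rewrite (eqP copq) muln1.
Qed.

Lemma order_v : #[v] = (g * n)%N.
Proof. by rewrite vgu orderJ order_u. Qed.

(** The relations put [(u ^+ g) ^+ p] and [(u ^+ g) ^+ q] in [<[v]>], hence
[u ^+ g] as well.  If conversely [u ^+ i = v ^+ j], the lattice condition reads
[i p = j q] and [j p + i q = 0] modulo [g n]; eliminating [j] shows that [g n]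
divides [i n]. *)
Lemma cycle_capI : <[u]> :&: <[v]> = C.
Proof.
apply/eqP; rewrite eqEsubset subsetI !cycle_subG groupX ?cycle_id //=.
apply/andP; split; last first.
  apply: (coprime_expg_in copq); rewrite -expgnA.
    by rewrite relation_u groupV mem_cycle.
  by rewrite -relation_v mem_cycle.
apply/subsetP=> _ /setIP[/cycleP[i ->] /cycleP[j uv]].
have{uv} /(frame_lattice F) : u ^+ i * v ^+ 0 = u ^+ 0 * v ^+ j.
  by rewrite mulg1 mul1g.
rewrite defN !mul0n !addn0 !add0n !(mulnCA _ g) -mulnDr -!muln_modr.
case=> /eqP; rewrite eqn_pmul2l // => /eqP eq1 /eqP.
rewrite mod0n eq_sym muln_eq0 gtn_eqF //= -/(dvdn _ _) => dvd2.
have : (g * n %| i * n)%N.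
  rewrite (_ : i * n = p * (i * p) + q * (i * q))%N; last by nia.
  rewrite /dvdn -modnDml -modnMmr eq1 modnMmr modnDml -/(dvdn _ _).
  have -> : (p * (j * q) + q * (i * q) = q * (j * p + i * q))%N by ring.
  exact: dvdn_mull.
rewrite dvdn_pmul2r // => /dvdnP[k ->].
by rewrite mulnC expgnA mem_cycle.
Qed.

Lemma card_translations : #|T| = (g * (g * n))%N.
Proof.
have := mul_cardG <[u]> <[v]>; rewrite -cent_joinEr // cycle_capI -!orderE.
rewrite orderXdiv order_u ?dvdn_mulr // order_v mulKn // mulnA => /eqP.
by rewrite eqn_pmul2r // => /eqP <-; rewrite mulnA mulnAC.
Qed.

Lemma cycle_vg : <[v ^+ g]> = C.
Proof.
apply/eqP; rewrite eqEcard -!orderE {2}vgu -conjXg orderJ leqnn andbT.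
rewrite -cycle_capI subsetI !cycle_subG.
rewrite [v ^+ g \in <[v]>]groupX ?cycle_id // andbT.
apply: (coprime_expg_in copq); rewrite -expgnA.
  by rewrite relation_v mem_cycle.
by rewrite -groupV -relation_u mem_cycle.
Qed.

Lemma expg_translations x : x \in T -> x ^+ g \in C.
Proof.
case/translationsP=> i [j ->].
rewrite expgMn; last exact/commuteX2/(frame_comm F).
rewrite -!expgnA ![(_ * g)%N]mulnC !expgnA groupM ?mem_cycle //=.
by rewrite -cycle_vg mem_cycle.
Qed.

(** Conjugation by [b] sends [u ^+ g] to the inverse of [v ^+ g], another
generator of [C]. *)
Lemma cycle_ug_normal : C <| G.
Proof.
have sCT : C \subset T by rewrite cycle_subG groupX.
rewrite /normal (subset_trans sCT) ?(normal_sub translations_normal) //=.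
rewrite -{1}(frame_gen F) join_subG !cycle_subG; apply/andP; split.
  rewrite (subsetP (cent_sub _)) // cent_cycle; apply/cent1P.
  exact/commuteX.
by rewrite inE -cycleJ conjXg (frame_uJ F) expgVn cycleV cycle_vg.
Qed.

(** * Bounding core-free subgroups *)

(** Subgroups of a normal cyclic group are normal. *)
Lemma corefree_cap_cycle_ug (H : {group gT}) : gcore H G = 1 -> H :&: C = 1.
Proof.
move=> coreH; apply/trivgP; rewrite -coreH gcore_max ?subsetIl //.
apply: normal_norm; apply: char_normal_trans cycle_ug_normal.
by rewrite sub_cyclic_char ?cycle_cyclic ?subsetIr.
Qed.

Lemma sub_translations_norm (K : {group gT}) :
  K \subset T -> b \in 'N(K) -> G \subset 'N(K).
Proof.
move=> sKT nKb; rewrite -(frame_gen F) join_subG !cycle_subG nKb andbT.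
rewrite (subsetP (cent_sub _)) //; apply: subsetP Tu.
by rewrite (subset_trans translations_abelian) ?centS.
Qed.

Lemma half_turn_invg x : x \in T -> x ^ (b * b) = x^-1.
Proof.
case/translationsP=> i [j ->].
have rot1 : (u ^+ i * v ^+ j) ^ b = v^-1 ^+ i * u ^+ j.
  by rewrite conjMg !conjXg (frame_uJ F) (frame_vJ F).
rewrite conjgM rot1 conjMg !conjXg conjVg (frame_uJ F) (frame_vJ F).
rewrite !expgVn -invMg.
by congr (_^-1); apply/commute_sym/commuteX2/(frame_comm F).
Qed.

Lemma half_turn_norm (K : {group gT}) : K \subset T -> b * b \in 'N(K).
Proof.
move=> sKT; rewrite inE; apply/subsetP=> _ /imsetP[x Kx ->].
by rewrite half_turn_invg ?groupV ?(subsetP sKT).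
Qed.

Lemma conj_sub_translations (K : {group gT}) : K \subset T -> K :^ b \subset T.
Proof.
move=> sKT; have /normsP nTb := normal_norm translations_normal.
by rewrite -(nTb b) ?conjSg.
Qed.

(** Conjugation by [b] has order 2 on the subgroups of [T], because [b ^+ 2]
inverts [T]; so two conjugates suffice. *)
Lemma gcore_translations (K : {group gT}) :
  K \subset T -> gcore K G = K :&: K :^ b.
Proof.
move=> sKT.
apply/eqP; rewrite eqEsubset subsetI gcore_sub /=; apply/andP; split.
  by rewrite -(normsP (gcore_norm K G) b Gb) conjSg gcore_sub.
apply: gcore_max; first exact: subsetIl.
apply: sub_translations_norm; first by rewrite subIset ?sKT.
by rewrite inE conjIg -conjsgM (normP (half_turn_norm sKT)) setIC.
Qed.

(** The product [L] of [K] and [K :^ b] is direct and has exponent dividing [g].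
Its order divides [g ^ 2]: one factor [g] bounds the cyclic group
[L :&: <[u]>], the other is the index of [<[u]>] in [T]. *)
Lemma corefree_translations_dvd (K : {group gT}) :
  K \subset T -> gcore K G = 1 -> #|K| %| g.
Proof.
move=> sKT coreK.
have expK x : x \in K -> x ^+ g = 1.
  move=> Kx; apply/set1gP; rewrite -(corefree_cap_cycle_ug coreK).
  by rewrite inE groupX //= expg_translations ?(subsetP sKT).
have abT := translations_abelian.
have sKbT := conj_sub_translations sKT.
pose L := (K <*> K :^ b)%G.
have sLT : L \subset T by rewrite join_subG sKT.
have defL : L = K * K :^ b :> {set gT}.
  apply: cent_joinEr; rewrite (subset_trans sKbT) //.
  by rewrite (subset_trans abT) ?centS.
have cardL : #|L| = (#|K| ^ 2)%N.
  by rewrite defL TI_cardMg ?cardJg ?mulnn // -gcore_translations.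
have expL : exponent L %| g.
  apply/exponentP=> x; rewrite defL => /mulsgP[y _ Ky /imsetP[z Kz ->] ->].
  rewrite expgMn -?conjXg ?expK ?conj1g ?mulg1 //.
  apply: (centsP abT); first exact: (subsetP sKT).
  by rewrite (subsetP sKbT) ?memJ_conjg.
rewrite -(@dvdn_pexp2r _ _ 2) // -cardL -(LagrangeI L <[u]>) expnS expn1.
apply: dvdn_mul.
  rewrite -exponent_cyclic ?(cyclicS (subsetIr _ _)) ?cycle_cyclic //.
  by rewrite (dvdn_trans (exponentS (subsetIl _ _))).
rewrite -(@dvdn_pmul2r #[u]) ?order_gt0 // LagrangeMr.
rewrite order_u -card_translations.
rewrite -norm_joinEl; first by rewrite cardSg // join_subG sLT cycle_subG.
rewrite (subset_trans sLT) // (subset_trans abT) //.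
by rewrite (subset_trans (centS _) (cent_sub _)) // cycle_subG.
Qed.

(** [H / (H :&: T)] embeds in [G / T], of order 4.  If it is all of [G / T],
then [G = H * T] normalises [H :&: T], which is therefore trivial. *)
Lemma corefree_card (H : {group gT}) : H \subset G -> gcore H G = 1 ->
  exists2 d, d %| g & [\/ #|H| = d, #|H| = (2 * d)%N | #|H| = 4].
Proof.
move=> sHG coreH; pose K := (H :&: T)%G.
have nTG := normal_norm translations_normal.
have coreK : gcore K G = 1.
  apply/trivgP; rewrite -coreH gcore_max ?gcore_norm //.
  by rewrite (subset_trans (gcore_sub _ _)) ?subsetIl.
have dvdg := corefree_translations_dvd (subsetIr _ _) coreK.
exists #|K| => //; rewrite -(LagrangeI H T) mulnC.
have sHTG : H * T \subset G.
  by rewrite mul_subG // (normal_sub translations_normal).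
have cardHT : (#|H : T| * #|T| = #|H * T|%g)%N by rewrite LagrangeMr.
have : #|H : T| %| 4.
  rewrite -(@dvdn_pmul2r #|T|) ?cardG_gt0 // -card_rotational cardHT.
  rewrite -norm_joinEl ?(subset_trans sHG) // cardSg //.
  by rewrite join_subG sHG (normal_sub translations_normal).
case iHT : #|H : T| => [|[|[|[|[]]]]] // _.
- by rewrite mul1n; constructor 1.
- by constructor 2.
have defG : H * T = G.
  by apply/eqP; rewrite eqEcard sHTG -cardHT iHT card_rotational leqnn.
suff -> : #|K| = 1%N by constructor 3.
apply/eqP; rewrite -trivg_card1 -subG1 -coreK sub_gcore // -defG mul_subG //.
  by rewrite normsI ?normG // (subset_trans sHG).
rewrite (subset_trans translations_abelian) //.
by rewrite (subset_trans (centS (subsetIr H _))) ?cent_sub.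
Qed.

(** * Constructing core-free subgroups *)

(** The generator is [(s1 + s2 i) / d].  If [j] times it equals [- l i] times it
modulo [s1 + s2 i], then [d] divides [j + l i], hence [j]. *)
Lemma corefree_cyclic d : d %| g ->
  exists K : {group gT}, [/\ K \subset T, #|K| = d & gcore K G = 1].
Proof.
case/dvdnP=> e def_g; have [e_gt0 d_gt0] : (0 < e)%N /\ (0 < d)%N.
  by apply/andP; rewrite -muln_gt0 -def_g.
pose x := u ^+ (e * p) * v ^+ (e * q).
have Tx : x \in T by rewrite groupM ?groupX.
have comX i j : commute (u ^+ i) (v ^+ j) by apply/commuteX2/(frame_comm F).
have xX j : x ^+ j = u ^+ (e * p * j) * v ^+ (e * q * j).
  by rewrite expgMn // -!expgnA.
have xbX l : (x ^ b) ^+ l = v ^- (e * p * l) * u ^+ (e * q * l).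
  by rewrite -conjXg xX conjMg !conjXg (frame_uJ F) (frame_vJ F) expgVn.
have eq_dvd j l : x ^+ j = (x ^ b) ^+ l -> d %| j.
  rewrite xX xbX => eq_x.
  have /(frame_lattice F)[eq_l _] :
      u ^+ (e * p * j) * v ^+ (e * q * j + e * p * l) =
      u ^+ (e * q * l) * v ^+ 0.
    by rewrite expgnDr mulgA eq_x mulg1 -mulgA comX mulKg.
  have {eq_l} : (g * (g * n) %| g * (e * j) * n)%N.
    rewrite -defN; move/eqP: eq_l; rewrite mul0n addn0.
    have -> : ((e * q * j + e * p * l) * (g * q) =
        e * q * j * (g * q) + e * q * l * (g * p))%N by ring.
    rewrite addnA.
    rewrite -{2}[(e * q * l * _)%N]add0n eqn_modDr mod0n -/(dvdn _ _).
    by rewrite (_ : _ * (g * p) + _ = g * (e * j) * n)%N //; ring.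
  by rewrite mulnA dvdn_pmul2r // dvdn_pmul2l // {1}def_g dvdn_pmul2l.
have ox : #[x] = d.
  apply/eqP; rewrite eqn_dvd order_dvdn; apply/andP; split; last first.
    by apply: (eq_dvd _ 0); rewrite expg_order.
  by rewrite xX !(mulnAC e _ d) -def_g; apply/eqP/(frame_rel F).
exists <[x]>%G; split=> //; first by rewrite cycle_subG.
rewrite gcore_translations ?cycle_subG //; apply/trivgP/subsetP=> y.
case/setIP=> /cycleP[j ->]; rewrite /= -cycleJ => /cycleP[l /eq_dvd].
by rewrite inE -ox order_dvdn.
Qed.

Lemma norm_cycle_b_join (K B : {group gT}) :
    K \subset T -> B \subset <[b]> -> B \subset 'N(K) ->
  [/\ K <*> B \subset G, (K <*> B) :&: T = K & #|K <*> B| = (#|K| * #|B|)%N].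
Proof.
move=> sKT sBb nKB; have [_ sbG _ _ nTb] := sdprod_context translations_sdprod.
have sTG := normal_sub translations_normal.
split.
- by rewrite join_subG (subset_trans sKT) ?(subset_trans sBb).
- rewrite norm_joinEr // -group_modl // setIC; apply/mulGidPl.
  by rewrite (subset_trans (setIS _ sBb)) // nTb sub1G.
- rewrite norm_joinEr // TI_cardMg //; apply/trivgP; rewrite -nTb.
  exact: setISS.
Qed.

Lemma half_turn_notin_cent : (2 < g * n)%N -> b * b \notin 'C(T).
Proof.
move=> gn_gt2; apply/negP=> /centP/(_ u Tu) comb.
have := half_turn_invg Tu; rewrite conjgE -comb mulKg => u1.
have : #[u] %| 2 by rewrite order_dvdn expgS expg1 {2}u1 mulgV.
by rewrite order_u => /(dvdn_leq (ltn0Sn 1)); rewrite leqNgt gn_gt2.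
Qed.

(** Every nontrivial power of [b] is [b ^+ 2] or has square [b ^+ 2], which
inverts [u] and does not fix it. *)
Lemma cent_translations : (2 < g * n)%N -> 'C_G(T) = T.
Proof.
move=> gn_gt2; apply/eqP; rewrite eqEsubset subsetI.
rewrite [T \subset 'C(T)]translations_abelian.
rewrite (normal_sub translations_normal) !andbT.
have [_ _ defG _ _] := sdprod_context translations_sdprod.
apply/subsetP=> x /setIP[]; rewrite -{1}defG => /mulsgP[t y Tt by_y ->].
have Ct : t \in 'C(T) by rewrite (subsetP translations_abelian).
rewrite groupMl // => Cy.
have Cyy : y * y \in 'C(T) by rewrite groupM.
have b2C := negP (half_turn_notin_cent gn_gt2).
rewrite groupMl //; case/cyclePmin: by_y Cy Cyy => i; rewrite order_b.
case: i => [|[|[|[|]]]] // _ ->.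
- by move=> _ _; apply: group1.
- by move=> _ /b2C.
- by move=> /b2C.
- rewrite -expgnDr -[(3 + 3)%N]/(4 + 2)%N expgnDr (frame_b4 F) mul1g.
  by move=> _ /b2C.
Qed.

(** The core of [H] and [T] are normal subgroups with trivial intersection, so
the core centralises [T] and is contained in it. *)
Lemma gcore_translations_trivg (H : {group gT}) :
  (2 < g * n)%N -> H \subset G ->
  gcore (H :&: T) G = 1 -> gcore H G = 1.
Proof.
move=> gn_gt2 sHG coreHT; have nTG := normal_norm translations_normal.
have tiT : gcore H G :&: T = 1.
  apply/trivgP; rewrite -coreHT gcore_max ?normsI ?gcore_norm //.
  by rewrite setSI ?gcore_sub.
rewrite -tiT; apply/esym/setIidPl; rewrite -(cent_translations gn_gt2).
have sMG : gcore H G \subset G by rewrite (subset_trans (gcore_sub H G)).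
rewrite subsetI sMG /=; apply/commG1P/trivgP; rewrite -tiT subsetI.
rewrite commg_subl commg_subr (subset_trans sMG) //.
by rewrite (subset_trans (normal_sub translations_normal)) ?gcore_norm.
Qed.

Lemma corefree_dihedral d : (2 < g * n)%N -> d %| g ->
  exists2 H : {group gT}, H \subset G /\ gcore H G = 1 & #|H| = (2 * d)%N.
Proof.
move=> gn_gt2 /corefree_cyclic[K [sKT <- coreK]].
have nKb2 : <[b ^+ 2]> \subset 'N(K) by rewrite cycle_subG half_turn_norm.
have [sHG HT cardH] := norm_cycle_b_join sKT (cycleX b 2) nKb2.
exists (K <*> <[b ^+ 2]>)%G; first by rewrite gcore_translations_trivg //= HT.
by rewrite cardH -orderE orderXdiv order_b // mulnC.
Qed.

Lemma corefree_cycle_b : (2 < g * n)%N -> <[b]> \subset G /\ gcore <[b]> G = 1.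
Proof.
move=> gn_gt2; have [_ sbG _ _ tiTb] := sdprod_context translations_sdprod.
split=> //; apply: gcore_translations_trivg => //; rewrite setIC tiTb.
by apply/trivgP; apply: gcore_sub.
Qed.

(** * The sets of degrees *)

Lemma degree_index (H : {group gT}) : H \subset G -> gcore H G = 1 ->
  faithful_transitive_degree G ((4 * (g * (g * n))) %/ #|H|).
Proof.
move=> sHG coreH; apply/faithful_transitive_degreeP.
by exists H; split; rewrite // -divgS // card_rotational card_translations.
Qed.

Lemma degrees_general m : (2 < g * n)%N ->
  faithful_transitive_degree G m <->
  [\/ m = g * (g * n),
      exists2 d : nat, d %| g & m = (2 * (g * (g * n))) %/ d
    | exists2 d : nat, d %| g & m = (4 * (g * (g * n))) %/ d]%N.
Proof.
move=> gn_gt2; split=> [/faithful_transitive_degreeP [H [sHG coreH <-]] | ].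
  rewrite -divgS // card_rotational card_translations.
  have [d d_g [->|->|->]] := corefree_card sHG coreH.
  - by constructor 3; exists d.
  - constructor 2; exists d => //.
    by rewrite -[4]/(2 * 2)%N -(mulnA 2) divnMl.
  - by constructor 1; rewrite mulKn.
case=> [-> | [d d_g ->] | [d d_g ->]].
- have [sbG coreb] := corefree_cycle_b gn_gt2.
  by have := degree_index sbG coreb; rewrite -orderE order_b mulKn.
- have [H [sHG coreH] cardH] := corefree_dihedral gn_gt2 d_g.
  have := degree_index sHG coreH.
  by rewrite cardH -[4]/(2 * 2)%N -(mulnA 2) divnMl.
- have [K [sKT cardK coreK]] := corefree_cyclic d_g.
  rewrite -cardK; apply: degree_index coreK.
  exact: subset_trans sKT (normal_sub translations_normal).
Qed.

(** Here [#|G| = 16] and the centre contains the Klein group [Z] generated by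
[u * v] and [b ^+ 2].  A core-free [H] meets [Z] trivially, so
[4 * #|H| = #|H * Z|] is at most 16, and it is not 16, since otherwise
[H] would be normalised by [G = H * Z] and so be trivial.  Of the orders below
4, only 1 and 2 divide 16. *)
Lemma card_corefree_small (H : {group gT}) : g = 2 -> n = 1%N ->
  H \subset G -> gcore H G = 1 -> #|H| = 1%N \/ #|H| = 2%N.
Proof.
move=> g2 n1 sHG coreH.
have cardG : #|G| = 16 by rewrite card_rotational card_translations g2 n1.
have u2 : u * u = 1 by have := expg_order u; rewrite order_u g2 n1.
have v2 : v * v = 1 by have := expg_order v; rewrite order_v g2 n1.
have uV : u^-1 = u by apply: (mulgI u); rewrite mulgV u2.
have vV : v^-1 = v by apply: (mulgI v); rewrite mulgV v2.
have cuvC := frame_comm F.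
pose Z := (<[u * v]> <*> <[b * b]>)%G.
have cG x : commute x u -> commute x b -> x \in 'C(G).
  move=> cxu cxb; rewrite -(frame_gen F) centY !cent_cycle inE.
  by apply/andP; split; apply/cent1P.
have cGw : u * v \in 'C(G).
  apply: cG; first by apply/commute_sym/commuteM.
  by apply/commgP/conjg_fixP; rewrite conjMg (frame_uJ F) (frame_vJ F) vV.
have cGbb : b * b \in 'C(G).
  apply: cG; last exact/commute_sym/commuteM.
  by apply/commute_sym/commgP/conjg_fixP; rewrite half_turn_invg.
have sZC : Z \subset 'C(G) by rewrite join_subG !cycle_subG cGw.
have sZG : Z \subset G by rewrite join_subG !cycle_subG !groupM.
have ow : #[u * v] = 2.
  apply: nt_prime_order => //.
    by rewrite expgMn // [u ^+ 2]u2 [v ^+ 2]v2 mulg1.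
  (* If [u * v = 1] then [u] is in [<[u]> :&: <[v]>], generated by
     [u ^+ 2 = 1]. *)
  apply/eqP=> uv1.
  have uvV : u = v^-1 by apply/eqP; rewrite eq_mulgV1 invgK uv1.
  have : u \in C by rewrite -cycle_capI inE cycle_id uvV groupV cycle_id.
  rewrite /= g2 [u ^+ 2]u2 cycle1 => /set1gP u1.
  by have := order_u; rewrite u1 order1 g2 n1.
have obb : #[b * b] = 2 by rewrite -[b * b]/(b ^+ 2) orderXdiv order_b.
have cardZ : #|Z| = 4.
  have [_ _ _ _ tiTb] := sdprod_context translations_sdprod.
  rewrite /= norm_joinEr; last first.
    rewrite cents_norm // cycle_subG (subsetP (centS _) _ cGbb) //.
    by rewrite cycle_subG groupM.
  rewrite TI_cardMg -?orderE ?ow ?obb //; apply/trivgP; rewrite -tiTb.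
  by apply: setISS; rewrite cycle_subG groupM ?cycle_id.
have cardHZ : (#|H * Z|%g = #|H| * 4)%N.
  rewrite TI_cardMg ?cardZ //; apply/trivgP.
  rewrite -coreH gcore_max ?subsetIl //.
  by rewrite cents_norm // centsC (subset_trans (subsetIr H Z)).
have nHZ : Z \subset 'N(H).
  by rewrite cents_norm // (subset_trans sZC) ?centS.
have sHZG : H <*> Z \subset G by rewrite join_subG sHG.
have ltH : #|H| < 4.
  rewrite ltnNge; apply/negP=> leH.
  have defG : H <*> Z = G.
    by apply/eqP; rewrite eqEcard sHZG norm_joinEr //= cardHZ cardG; lia.
  have H1 : H = 1 :> {set gT}.
    by apply/trivgP; rewrite -coreH gcore_max // -defG join_subG normG nHZ.
  by rewrite H1 cards1 in leH.
have : #|H| %| 16 by rewrite -cardG cardSg.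
have := cardG_gt0 H; case: #|H| ltH => [|[|[|[|]]]] //; by [left | right].
Qed.

Lemma degrees_small m : g = 2 -> n = 1%N ->
  faithful_transitive_degree G m <-> m = 8 \/ m = 16.
Proof.
move=> g2 n1; split=> [/faithful_transitive_degreeP [H [sHG coreH <-]] | m816].
  rewrite -divgS // card_rotational card_translations g2 n1.
  by have [-> | ->] := card_corefree_small g2 n1 sHG coreH; [right | left].
have [d d_g ->] : exists2 d, d %| g & m = (4 * (g * (g * n))) %/ d.
  by case: m816 => ->; [exists 2 | exists 1%N]; rewrite g2 ?n1.
have [K [sKT <- coreK]] := corefree_cyclic d_g.
apply: degree_index coreK.
exact: subset_trans sKT (normal_sub translations_normal).
Qed.

End FrameTheory.

Lemma leq_add_sqr m n : m + n <= m ^ 2 + n ^ 2.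
Proof.
by rewrite -!mulnn leq_add //; [case: m | case: n] => // k; rewrite leq_pmulr.
Qed.

Theorem theorem4p3 (s1 s2 : nat) (gT : finGroupType) (G : {group gT}) :
  rotational_group_44 s1 s2 G ->
  let N := s1 ^ 2 + s2 ^ 2 in
  let D := divisors (gcdn s1 s2) in
  (2 < s1 + s2 ->
   forall n : nat, faithful_transitive_degree G n <->
     [\/ n = N,
         exists2 d : nat, d \in D & n = (2 * N) %/ d
       | exists2 d : nat, d \in D & n = (4 * N) %/ d])
  /\ ((s1, s2) = (0, 2) \/ (s1, s2) = (2, 0) ->
      forall n : nat, faithful_transitive_degree G n <-> n = 8 \/ n = 16).
Proof.
move=> isoG N D; split=> [s_gt2 m | s_small m].
- have g_gt0 : 0 < gcdn s1 s2 by rewrite gcdn_gt0; lia.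
  have N_gt2 : 2 < N := leq_trans s_gt2 (leq_add_sqr s1 s2).
  have [b [u [v F]]] := rotational_group_44_frame isoG N_gt2.
  have [p def_s1] := dvdnP (dvdn_gcdl s1 s2).
  have [q def_s2] := dvdnP (dvdn_gcdr s1 s2).
  rewrite /D; set g := gcdn s1 s2 in g_gt0 def_s1 def_s2 *.
  have copq : coprime p q.
    by rewrite /coprime -(@eqn_pmul2r g) // muln_gcdl -def_s1 -def_s2 mul1n.
  rewrite mulnC in def_s1; rewrite mulnC in def_s2.
  have defN : N = g * (g * (p ^ 2 + q ^ 2)) by rewrite /N def_s1 def_s2; ring.
  (* [n] is at least [p + q], so [g * n] is at least [s1 + s2]. *)
  have gn_gt2 : 2 < g * (p ^ 2 + q ^ 2).
    apply: leq_trans s_gt2 _; rewrite {1}def_s1 {1}def_s2 -mulnDr leq_mul2l.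
    by rewrite leq_add_sqr orbT.
  rewrite def_s1 def_s2 in F.
  have := degrees_general g_gt0 copq F m gn_gt2; rewrite -defN => ->.
  have memD d : (d \in divisors g) = (d %| g) by rewrite -dvdn_divisors.
  split=> -[->|[d d_g ->]|[d d_g ->]].
  - by constructor 1.
  - by constructor 2; exists d; rewrite ?memD.
  - by constructor 3; exists d; rewrite ?memD.
  - by constructor 1.
  - by constructor 2; exists d; rewrite -?memD.
  - by constructor 3; exists d; rewrite -?memD.
have N_gt2 : 2 < N by rewrite /N; case: s_small => -[-> ->].
have [b [u [v F]]] := rotational_group_44_frame isoG N_gt2.
case: s_small => -[es1 es2]; rewrite {}es1 {}es2 in F.
  exact: (@degrees_small 2 0 1 gT G b u v).
exact: (@degrees_small 2 1 0 gT G b u v).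
Qed.
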